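(* Let $n\ge 3$. On the set $\mathcal{A}$ of all signed permutations of $n$, with descent map $\mathrm{Des}$, the maps $\{\varphi_i\}_{1<i<n}$ defined below form a weak dual equivalence for $(\mathcal{A},\mathrm{Des})$. Definition of $\varphi_i$: for a signed permutation $w$, let $a,b,c$ be the letters with absolute values $\{i-1,i,i+1\}$ listed in the order they occur from left to right in $w$. If $i\notin\mathrm{Spike}(\mathrm{Des}(w))$, then $\varphi_i(w)=w$; otherwise, if exactly one of $b,c$ is signed, $\varphi_i(w)$ swaps the signs of $b$ and $c$; otherwise $\varphi_i(w)$ swaps $a$ and $c$, leaving the signs in their original positions.
   Context: A signed permutation of $n$ is a permutation (word) of $\{1,\dots,n\}$ together with a choice of sign (signed/unsigned) for each value; ''$i$ is signed'' refers to the letter of absolute value $i$. Its descent set is $\mathrm{Des}(w)=\{i : i \text{ is unsigned and lies to the right of } i+1, \text{ or } i+1 \text{ is signed and lies to the right of } i\}\subseteq\{1,\dots,n-1\}$. For $D\subseteq\{1,\dots,n-1\}$, $\mathrm{Spike}(D)=\{i\in\{2,\dots,n-1\}: \text{exactly one of } i-1,\ i \text{ lies in } D\}$. For $D\subseteq\{1,\dots,n-1\}$, $F_D(X)=\sum x_{i_1}\cdots x_{i_n}$ over $i_1\le\cdots\le i_n$ with $i_j=i_{j+1}\Rightarrow j\notin D$ (fundamental quasisymmetric function); a function is Schur positive if it is a nonnegative integer combination of Schur functions. Weak dual equivalence. Let $\mathcal{A}$ be finite with $\mathrm{Des}(T)\subseteq\{1,\dots,n-1\}$ for $T\in\mathcal{A}$,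 and let $\{\varphi_i\}_{1<i<n}$ be involutions on $\mathcal{A}$. Write $\mathcal{A}^{\varphi_i}$ for the fixed points of $\varphi_i$. For $1<j<i<n$, $[T]_{(j,i)}$ is the equivalence class of $T$ under the group generated by $\varphi_j,\dots,\varphi_i$, and $\mathrm{Des}_{(j,i)}(T)$ is obtained by intersecting $\mathrm{Des}(T)$ with $\{j-1,\dots,i\}$ and subtracting $j-2$ from each element. The family is a weak dual equivalence if: (i) $\mathcal{A}^{\varphi_i}=\{T: i-1\in\mathrm{Des}(T)\Leftrightarrow i\in\mathrm{Des}(T)\}$; (ii) for $T\notin\mathcal{A}^{\varphi_i}$: $h\in\mathrm{Des}(T)\Leftrightarrow h\in\mathrm{Des}(\varphi_i(T))$ for $h<i-2$ or $h>i+1$; $i-2\in\mathrm{Des}(T)\Leftrightarrow i-2\notin\mathrm{Des}(\varphi_i(T))$ only if $T\notin\mathcal{A}^{\varphi_{i-1}}$; $i+1\in\mathrm{Des}(T)\Leftrightarrow i+1\notin\mathrm{Des}(\varphi_i(T))$ only if $T\notin\mathcal{A}^{\varphi_{i+1}}$; and for $j\in\{i-1,i\}$, $j\in\mathrm{Des}(T)\Leftrightarrow j\notin\mathrm{Des}(\varphi_i(T))$; (iii) $\varphi_j\varphi_i(T)=\varphi_i\varphi_j(T)$ for all $T$ whenever $|i-j|\ge 3$; (iv-a) for every $T$, $\sum_{U\in[T]_{(i-1,i)}}F_{\mathrm{Des}_{(i-1,i)}(U)}(X)$ is Schur positive; moreover, if $T,\varphi_i(T)\notin\mathcal{A}^{\varphi_{i-1}}\cup\mathcal{A}^{\varphi_i}\cup\mathcal{A}^{\varphi_{i+1}}$,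 then $\{\mathrm{Des}_{(i-1,i)}(U): U\in[T]_{(i-1,i)}\}=\{\mathrm{Des}_{(i,i+1)}(U): U\in[T]_{(i,i+1)}\}$; (iv-b) for every $T$, $\sum_{U\in[T]_{(i-2,i)}}F_{\mathrm{Des}_{(i-2,i)}(U)}(X)$ is Schur positive; moreover, if $T,\varphi_i(T)\notin\mathcal{A}^{\varphi_{i+1}}$ and $\varphi_i\varphi_{i-2}(T)\in\mathcal{A}^{\varphi_{i+1}}$, then, setting $U=\varphi_i(T)$, for all $m\ge1$ such that $(\varphi_i\varphi_{i-2})^{m-1}(U)\notin\mathcal{A}^{\varphi_{i-2}}$ and $\varphi_{i-2}(\varphi_i\varphi_{i-2})^{m-1}(U)\notin\mathcal{A}^{\varphi_i}$, one has $(\varphi_i\varphi_{i-2})^m(U)\notin\mathcal{A}^{\varphi_{i+1}}$.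
   Formalization: In (iv-b), second half, T is also required not to be fixed by φ_i, and the non-fixedness conditions are required for every m' ≤ m, not only m; as written the condition fails, e.g. n=6, i=4, T = 1 2 4 -3 5 -6, m=1. *)

(* Defs.v *)
From mathcomp Require Import all_boot fingroup perm finmap multiset.

Set Implicit Arguments.
Unset Strict Implicit.
Unset Printing Implicit Defensive.

Local Open Scope nat_scope.
Local Open Scope fset_scope.
Local Open Scope mset_scope.

(* A monomial in the countably many variables x_0, x_1, ... is the multiset of
   the indices of its variables; a power series is its coefficient function.
   Only series with coefficients in nat are needed. *)
Definition series := {mset nat} -> nat.

(* F_D in degree k.  The sequences (i_1, ..., i_k) whose monomial is m are the
   rearrangements of m, so the coefficient counts the admissible ones;
   i_j is [nth 0 t j.-1]. *)
Definition fundamental (k : nat) (D : {fset nat}) : series := fun m =>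
  count
    (fun t => [&& size t == k, sorted leq t
                & all (fun j => (nth 0 t j.-1 == nth 0 t j) ==> (j \notin D))
                      (iota 1 k.-1)])
    (permutations m).

Definition is_partition (lam : seq nat) : bool :=
  sorted geq lam && (0 \notin lam).

(* [t] is the row reading of a filling of the diagram of [lam] (English
   notation). *)
Definition semistandard (lam t : seq nat) : bool :=
  let rows := reshape lam t in
  [&& size t == sumn lam, all (sorted leq) rows
    & sorted (fun r1 r2 => all2 ltn (take (size r2) r1) r2) rows].

(* The coefficient of x^m in s_lam is the number of semistandard Young tableaux
   of shape [lam] and content [m]. *)
Definition schur (lam : seq nat) : series := fun m =>
  count (semistandard lam) (permutations m).

Definition schur_positive (f : series) : Prop :=
  exists (L : seq (seq nat)) (c : seq nat -> nat),
    all is_partition L /\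
    forall m, f m = \sum_(lam <- L) c lam * schur lam m.

Definition spike (n : nat) (D : {fset nat}) : {fset nat} :=
  [fset i in iota 2 n.-2 | (i.-1 \in D) (+) (i \in D)].

Section WeakDualEquivalence.

Variables (A : finType) (n : nat) (Des : A -> {fset nat}) (phi : nat -> A -> A).

Definition fixpts (i : nat) : {set A} := [set T | phi i T == T].

(* The phi_h are involutions, so the orbit of T under the group they generate
   consists of the elements reachable from T by applying the phi_h. *)
Definition wde_class (j i : nat) (T : A) : {set A} :=
  [set U | connect
             (fun V W => has (fun h => phi h V == W) (iota j (i.+1 - j))) T U].

Definition des_restr (j i : nat) (T : A) : {fset nat} :=
  [fset h - (j - 2) | h in Des T & (j.-1 <= h <= i)].

(* [des_restr j i U] is a subset of {1, ..., i - j + 2}. *)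
Definition wde_gf (j i : nat) (T : A) : series := fun m =>
  \sum_(U in wde_class j i T) fundamental (i - j + 3) (des_restr j i U) m.

Definition des_sets (j i : nat) (T : A) : {fset {fset nat}} :=
  [fset des_restr j i U | U in wde_class j i T].

(* Each clause is required for those i for which every phi_h it involves has
   1 < h < n.  Clause [wde_chain] follows the path
     T, U = phi_i T, phi_{i-2} U, phi_i phi_{i-2} U, phi_{i-2} phi_i phi_{i-2} U,
     ...
   and constrains (phi_i phi_{i-2})^m U only while the path has not stopped, that
   is, while every phi applied so far (the first one, T -> U, included) moves
   its argument.  Past its end the path would run back through T to
   phi_i phi_{i-2} T, which the hypothesis puts in A^{phi_{i+1}}. *)
Record weak_dual_equivalence : Prop := WeakDualEquivalence {
  wde_des : forall T h, h \in Des T -> 0 < h < n;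
  wde_inv : forall i, 1 < i < n -> involutive (phi i);
  wde_fix : forall i, 1 < i < n ->
    fixpts i = [set T | (i.-1 \in Des T) == (i \in Des T)];
  wde_des_far : forall i T, 1 < i < n -> T \notin fixpts i ->
    forall h, h < i - 2 \/ i.+1 < h ->
    (h \in Des T <-> h \in Des (phi i T));
  wde_des_left : forall i T, 1 < i < n -> T \notin fixpts i ->
    (i - 2 \in Des T <-> i - 2 \notin Des (phi i T)) -> T \notin fixpts i.-1;
  wde_des_right : forall i T, 1 < i < n -> T \notin fixpts i ->
    (i.+1 \in Des T <-> i.+1 \notin Des (phi i T)) -> T \notin fixpts i.+1;
  wde_des_mid : forall i T, 1 < i < n -> T \notin fixpts i ->
    forall j, j = i.-1 \/ j = i ->
    (j \in Des T <-> j \notin Des (phi i T));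
  wde_comm : forall i j T, 1 < i < n -> 1 < j < n ->
    (i + 3 <= j) || (j + 3 <= i) -> phi j (phi i T) = phi i (phi j T);
  wde_schur2 : forall i T, 2 < i < n -> schur_positive (wde_gf i.-1 i T);
  wde_des_sets : forall i T, 2 < i -> i.+1 < n ->
    T \notin fixpts i.-1 :|: fixpts i :|: fixpts i.+1 ->
    phi i T \notin fixpts i.-1 :|: fixpts i :|: fixpts i.+1 ->
    des_sets i.-1 i T = des_sets i i.+1 T;
  wde_schur3 : forall i T, 3 < i < n -> schur_positive (wde_gf (i - 2) i T);
  wde_chain : forall i T, 3 < i -> i.+1 < n -> T \notin fixpts i ->
    T \notin fixpts i.+1 -> phi i T \notin fixpts i.+1 ->
    phi i (phi (i - 2) T) \in fixpts i.+1 ->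
    let U := phi i T in
    let psi V := phi i (phi (i - 2) V) in
    forall m, 0 < m ->
      (forall l, l < m ->
         iter l psi U \notin fixpts (i - 2) /\
         phi (i - 2) (iter l psi U) \notin fixpts i) ->
      iter m psi U \notin fixpts i.+1
}.

End WeakDualEquivalence.

(* The p-th letter of w (p : 'I_n, counted from 0) has absolute value
   (w.1 p).+1, and it is signed iff w.2 p. *)
Definition signed_perm (n : nat) : finType :=
  ({perm 'I_n} * {ffun 'I_n -> bool})%type.

Section SignedPermutations.

Variable n : nat.
Implicit Type w : signed_perm n.

Definition absval w (p : 'I_n) : nat := (w.1 p).+1.

Definition signed w (i : nat) : bool :=
  [exists p, (absval w p == i) && w.2 p].

Definition right_of w (i j : nat) : bool :=
  [exists p, exists q, [&& absval w p == i, absval w q == j & q < p]].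

Definition sp_des w : {fset nat} :=
  [fset i in iota 1 n.-1 |
     (~~ signed w i && right_of w i i.+1) ||
     (signed w i.+1 && right_of w i.+1 i)].

Definition swap_signs (p q : 'I_n) w : signed_perm n :=
  (w.1, [ffun r => w.2 (tperm p q r)]).

Definition swap_values (p q : 'I_n) w : signed_perm n :=
  ((tperm p q * w.1)%g, w.2).

(* [a; b; c] are the positions of the letters with absolute values i-1, i, i+1,
   from left to right; for 1 < i < n there are always exactly three. *)
Definition sp_phi (i : nat) w : signed_perm n :=
  if i \in spike n (sp_des w) then
    match [seq p <- enum 'I_n | absval w p \in [:: i.-1; i; i.+1]] with
    | [:: a; b; c] =>
        if w.2 b (+) w.2 c then swap_signs b c w else swap_values a c w
    | _ => w
    end
  else w.

End SignedPermutations.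

(* Main.v *)
Require Import Defs.
From mathcomp Require Import all_boot fingroup perm finmap multiset zify.

(**
A signed permutation is read as a word of signed letters.  Whether [h] is a
descent depends only on the subword of the values [h, h+1], and [phi_i] is a
substitution of the letters of values [i-1, i, i+1] that depends only on their
subword.  Hence both commute with restriction to a window of consecutive values,
and a signed permutation whose letters outside the window are known is determined
by its pattern on the window.  Apart from the axioms on
distant indices, which are immediate from this locality, each axiom concerns a
window of at most six letters and becomes a finite
check on signed patterns.  For Schur positivity, [s_lam] is expanded into
fundamental quasisymmetric functions indexed by standard tableaux; as coefficients
depend only on the relative order of the variables, in degrees 4 and 5 this is
also a finite check.  The second half of (iv-a) holds vacuously: no [T] satisfies
its hypotheses.
*)

Set Implicit Arguments.
Unset Strict Implicit.
Unset Printing Implicit Defensive.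

(** * Words and windows *)

Definition letter := (nat * bool)%type.
Definition word := seq letter.

Definition subword (P : pred nat) (u : word) : word := [seq x <- u | P x.1].

Definition pair_at (h : nat) : pred nat := fun v => (v == h) || (v == h.+1).
Definition triple_at (i : nat) : pred nat :=
  fun v => [|| v == i.-1, v == i | v == i.+1].

(* Of two consecutive values, the rightmost letter [y] decides: [h] is a descent
   iff [y] is signed when [h] comes first, and unsigned when [h.+1] does. *)
Definition descent (h : nat) (u : word) : bool :=
  if subword (pair_at h) u is [:: x; y] then (x.1 == h) == y.2 else false.

Definition spiked (i : nat) (u : word) : bool := descent i.-1 u (+) descent i u.

(** [t] is meant to be the subword of the values i-1, i, i+1, read from left to right. A letter is
    recognised by its value alone, as each value occurs once in the words of interest. Exchanging
    values while keeping [x.2] leaves the signs in their positions. *)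
Definition move_letter (i : nat) (t : word) (x : letter) : letter :=
  if t is [:: a; b; c] then
    if spiked i t then
      if b.2 (+) c.2 then
        if x.1 == b.1 then (x.1, c.2)
        else if x.1 == c.1 then (x.1, b.2) else x
      else
        if x.1 == a.1 then (c.1, x.2)
        else if x.1 == c.1 then (a.1, x.2) else x
    else x
  else x.

(* [sp_phi i] as a letter-by-letter substitution that depends only on the subword
   of the values i-1, i, i+1; this is what makes it local. *)
Definition move (i : nat) (u : word) : word :=
  map (move_letter i (subword (triple_at i) u)) u.

Lemma subword_sub (P Q : pred nat) (u : word) :
  subpred P Q -> subword P (subword Q u) = subword P u.
Proof.
move=> PQ; rewrite /subword -filter_predI; apply: eq_filter => x /=.
by apply/andP/idP => [[]|Px] //; split=> //; apply: PQ.
Qed.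

Lemma descent_subword (P : pred nat) h u :
  P h -> P h.+1 -> descent h (subword P u) = descent h u.
Proof.
move=> Ph Ph1; rewrite /descent subword_sub //.
by move=> v /orP[]/eqP->.
Qed.

Lemma spiked_subword (P : pred nat) i u : 0 < i ->
  P i.-1 -> P i -> P i.+1 -> spiked i (subword P u) = spiked i u.
Proof.
by move=> i0 P1 P2 P3; rewrite /spiked !descent_subword ?prednK.
Qed.

Lemma move_letter_out i u x :
  ~~ triple_at i x.1 -> move_letter i (subword (triple_at i) u) x = x.
Proof.
move=> xN; have: all (fun y => triple_at i y.1) (subword (triple_at i) u).
  exact: filter_all.
have neq y : triple_at i y -> (x.1 == y) = false.
  by move=> yi; apply: contraNF xN => /eqP->.
rewrite /move_letter; case: subword => [|a [|b [|c [|d t]]]] //=.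
case/and4P=> /neq ea /neq eb /neq ec _.
by rewrite ea eb ec; case: ifP => // _; case: ifP.
Qed.

Lemma triple_move_letter i u x :
  triple_at i (move_letter i (subword (triple_at i) u) x).1 = triple_at i x.1.
Proof.
have: all (fun y => triple_at i y.1) (subword (triple_at i) u).
  exact: filter_all.
rewrite /move_letter; case: subword => [|a [|b [|c [|d t]]]] //=.
case/and4P=> ai bi ci _; do 2 case: ifP => // _.
- by do 2 case: ifP => // _.
- case: ifP => [/eqP->|_]; first by rewrite ai ci.
  by case: ifP => // /eqP->; rewrite ai ci.
Qed.

(** [P] does not separate the three values that [move i] may exchange, so the move keeps the set of
    positions whose letters satisfy [P]. *)
Definition compatible (P : pred nat) (i : nat) : Prop :=
  {in triple_at i &, forall v v', P v = P v'}.

Lemma compatible_in (P : pred nat) i : subpred (triple_at i) P -> compatible P i.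
Proof. by move=> iP v v' vi v'i; rewrite !iP. Qed.

Lemma compatible_out (P : pred nat) i :
  subpred (triple_at i) (predC P) -> compatible P i.
Proof.
by move=> iP v v' vi v'i; rewrite (negbTE (iP _ vi)) (negbTE (iP _ v'i)).
Qed.

Lemma compatible_move P i u x : compatible P i ->
  P (move_letter i (subword (triple_at i) u) x).1 = P x.1.
Proof.
move=> iP; have [xi|/move_letter_out-> //] := boolP (triple_at i x.1).
by apply: iP => //; rewrite -topredE /= triple_move_letter.
Qed.

Lemma mask_move P i u : compatible P i ->
  map (fun x => P x.1) (move i u) = map (fun x => P x.1) u.
Proof.
by move=> iP; rewrite -map_comp; apply: eq_map => x /=; rewrite compatible_move.
Qed.

Lemma subword_move_out P i u : subpred (triple_at i) (predC P) ->
  subword P (move i u) = subword P u.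
Proof.
move=> iP; rewrite /subword filter_map.
rewrite (eq_filter (a2 := fun x => P x.1)) => [|x /=]; last first.
  by rewrite compatible_move //; exact: compatible_out.
rewrite -[RHS]map_id; apply/eq_in_map => x; rewrite mem_filter => /andP[Px _].
by rewrite move_letter_out //; apply/negP => /iP /=; rewrite Px.
Qed.

(** Locality: the substitution is governed by the subword of its triple, and restriction to [P]
    keeps that subword. *)
Lemma subword_move_in P i u : subpred (triple_at i) P ->
  subword P (move i u) = move i (subword P u).
Proof.
move=> iP; rewrite /move subword_sub // {1}/subword filter_map; congr map.
by apply: eq_filter => x /=; rewrite compatible_move //; exact: compatible_in.
Qed.

(** The common mask tells at each position which of the two subwords supplies the next letter, so
    they can be shuffled back together. *)
Lemma eq_from_subwords (P : pred nat) (u v : word) :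
  map (fun x => P x.1) u = map (fun x => P x.1) v ->
  subword P u = subword P v -> subword (predC P) u = subword (predC P) v ->
  u = v.
Proof.
elim: u v => [|x u IH] [|y v] //= [exy euv].
rewrite -exy; case: (P x.1) => /=.
- by move=> [-> e1] e2; rewrite (IH v).
- by move=> e1 [-> e2]; rewrite (IH v).
Qed.

Lemma descent_move_far h i u : h < i - 2 \/ i.+1 < h ->
  descent h (move i u) = descent h u.
Proof.
move=> hi; rewrite /descent subword_move_out // => v.
by rewrite /= /triple_at /pair_at; lia.
Qed.

(** The two triples of values are disjoint: neither move alters the subword that governs the other,
    and no letter is changed by both. *)
Lemma move_comm i j u : i + 3 <= j -> move j (move i u) = move i (move j u).
Proof.
move=> ij; rewrite {1}/move {3}/move subword_move_out ?subword_move_out;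
  try by move=> v; rewrite /= /triple_at; lia.
rewrite /move -!map_comp; apply: eq_map => x /=.
have [xi|xi] := boolP (triple_at i x.1).
- have xj : ~~ triple_at j x.1 by move: xi; rewrite /triple_at; lia.
  rewrite (move_letter_out _ xj) move_letter_out //.
  have := triple_move_letter i u x; rewrite xi /triple_at; lia.
- rewrite (move_letter_out _ xi).
  have [xj|xj] := boolP (triple_at j x.1); last first.
    by rewrite !move_letter_out.
  rewrite [RHS]move_letter_out //.
  have := triple_move_letter j u x; rewrite xj /triple_at; lia.
Qed.

(** * Windows of consecutive values, renumbered from 1 *)

Definition window (s k : nat) : pred nat := fun v => s < v <= s + k.

Definition shift (s : nat) (x : letter) : letter := (s + x.1, x.2).

Definition pattern (s k : nat) (u : word) : word :=
  [seq (x.1 - s, x.2) | x <- subword (window s k) u].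

Lemma shift_pattern s k u :
  map (shift s) (pattern s k u) = subword (window s k) u.
Proof.
rewrite -map_comp -[RHS]map_id; apply/eq_in_map => -[v b].
by rewrite mem_filter /window /shift /= => /andP[/andP[/ltnW sv _] _]; rewrite subnKC.
Qed.

Lemma shift_inj s : injective (shift s).
Proof. by move=> [v b] [v' b'] [/addnI-> ->]. Qed.

Lemma subword_shift P s u :
  subword P (map (shift s) u) = map (shift s) (subword (fun v => P (s + v)) u).
Proof. by rewrite /subword filter_map. Qed.

Lemma descent_shift s h u : descent (s + h) (map (shift s) u) = descent h u.
Proof.
rewrite /descent subword_shift.
rewrite (_ : subword _ u = subword (pair_at h) u); last first.
  by apply: eq_filter => x; rewrite /pair_at -addnS !eqn_add2l.
by case: subword => [|x [|y []]] //=; rewrite eqn_add2l.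
Qed.

Lemma spiked_shift s i u : 0 < i ->
  spiked (s + i) (map (shift s) u) = spiked i u.
Proof.
by case: i => // i _; rewrite /spiked addnS /= -addnS !descent_shift.
Qed.

Lemma move_shift s i u : 0 < i ->
  move (s + i) (map (shift s) u) = map (shift s) (move i u).
Proof.
move=> i0; rewrite /move subword_shift.
rewrite (_ : subword _ u = subword (triple_at i) u); last first.
  apply: eq_filter => x; rewrite /triple_at; lia.
rewrite -!map_comp; apply: eq_map => x /=; set t := subword _ _.
have := spiked_shift s t i0; rewrite /move_letter.
case: t => [|a [|b [|c [|d t]]]] //= ->; case: ifP => // _.
rewrite !eqn_add2l; case: ifP => _; do ?case: ifP => // _.
Qed.

Section Pattern.

Variables s k : nat.

Lemma pattern_move i u : 1 < i < k ->
  pattern s k (move (s + i) u) = move i (pattern s k u).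
Proof.
move=> ik; apply: (inj_map (@shift_inj s)).
rewrite -move_shift ?shift_pattern; last by lia.
by rewrite subword_move_in // => v; rewrite /triple_at /window; lia.
Qed.

Lemma descent_pattern h u : 0 < h < k ->
  descent h (pattern s k u) = descent (s + h) u.
Proof.
by move=> hk; rewrite -(descent_shift s) shift_pattern descent_subword //
  /window; lia.
Qed.

Lemma spiked_pattern i u : 1 < i < k ->
  spiked i (pattern s k u) = spiked (s + i) u.
Proof.
move=> ik; rewrite -(spiked_shift s) ?shift_pattern; last by lia.
by rewrite spiked_subword // /window; lia.
Qed.

(** What a pattern forgets: which positions the window occupies, and the letters elsewhere. Moves
    inside the window preserve it. *)
Definition same_outside (u v : word) : Prop :=
  map (fun x => window s k x.1) u = map (fun x => window s k x.1) v /\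
  subword (predC (window s k)) u = subword (predC (window s k)) v.

Lemma pattern_inj u v :
  same_outside u v -> pattern s k u = pattern s k v -> u = v.
Proof.
move=> [e1 e2] /(congr1 (map (shift s))); rewrite !shift_pattern.
by move=> e3; apply: (eq_from_subwords e1).
Qed.

Lemma same_outside_move i u v : 1 < i < k ->
  same_outside u v -> same_outside u (move (s + i) v).
Proof.
move=> ik [e1 e2]; rewrite /same_outside e1 e2.
have iW : subpred (triple_at (s + i)) (window s k).
  by move=> x; rewrite /triple_at /window; lia.
split; first by rewrite mask_move //; apply: compatible_in.
by rewrite subword_move_out // => x /iW /=; rewrite negbK.
Qed.

End Pattern.

Fixpoint bits (k : nat) : seq (seq bool) :=
  if k is k'.+1 then map (cons true) (bits k') ++ map (cons false) (bits k')
  else [:: [::]].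

Definition patterns (k : nat) : seq word :=
  [seq zip v b | v <- permutations (iota 1 k), b <- bits k].

Lemma mem_bits (b : seq bool) : b \in bits (size b).
Proof.
elim: b => [|x b IH] //=; rewrite mem_cat; apply/orP.
by case: x; [left | right]; apply: map_f.
Qed.

(** * Signed permutations as words *)

Lemma mem_patterns k (p : word) :
  perm_eq (map fst p) (iota 1 k) -> p \in patterns k.
Proof.
move=> pk; have sp : size p = k.
  by rewrite -(size_map fst) (perm_size pk) size_iota.
apply/allpairsP; exists (map fst p, map snd p); split => /=.
- by rewrite mem_permutations.
- by rewrite -sp -(size_map snd) mem_bits.
- by rewrite -/(unzip1 p) -/(unzip2 p) zip_unzip.
Qed.

Section SignedPermutationWords.

Variable n : nat.
Implicit Types (w T U : signed_perm n) (p q : 'I_n).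

Definition letter_at w p : letter := (absval w p, w.2 p).

Definition word_of w : word := map (letter_at w) (enum 'I_n).

Lemma absval_inj w : injective (absval w).
Proof. by move=> p q [/val_inj/perm_inj]. Qed.

Lemma word_of_inj : injective word_of.
Proof.
move=> w w' /eq_in_map e.
have ep p : letter_at w p = letter_at w' p by apply: e; rewrite mem_enum.
case: w w' ep {e} => [f b] [f' b'] ep; congr pair.
- by apply/permP => p; case: (ep p) => /val_inj.
- by apply/ffunP => p; case: (ep p).
Qed.

Lemma absval_onto w v : 0 < v <= n -> exists p, absval w p = v.
Proof.
case: v => // v vn; exists ((w.1)^-1%g (Ordinal (vn : v < n))).
by rewrite /absval permKV.
Qed.

Lemma absval_bound w p : 0 < absval w p <= n.
Proof. by rewrite /absval /=. Qed.

(** A strictly increasing list is determined by its elements; this turns the order of two positions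
    into an explicit subword. *)
Lemma filter_enum_sorted (ps : seq 'I_n) (P : pred 'I_n) :
  sorted (fun p q => p < q) ps -> P =i ps -> [seq p <- enum 'I_n | P p] = ps.
Proof.
move=> ps_sorted Pps.
apply: (@irr_sorted_eq _ (fun p q : 'I_n => p < q)) => //.
- by move=> a b c; apply: ltn_trans.
- by move=> a; rewrite /= ltnn.
- apply: sorted_filter; first by move=> a b c; apply: ltn_trans.
  have := iota_ltn_sorted 0 n; rewrite -val_enum_ord sorted_map //.
- by move=> p; rewrite mem_filter mem_enum andbT; exact: Pps.
Qed.

Lemma subword_word_of (P : pred nat) w :
  subword P (word_of w) =
  map (letter_at w) [seq p <- enum 'I_n | P (absval w p)].
Proof. by rewrite /subword filter_map. Qed.

Lemma map_fst_word_of w : perm_eq (map fst (word_of w)) (iota 1 n).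
Proof.
apply: uniq_perm; rewrite ?iota_uniq //.
- by rewrite -map_comp map_inj_uniq ?enum_uniq //; exact: absval_inj.
- move=> v; rewrite mem_iota add1n ltnS; apply/mapP/idP.
  + by move=> [_ /mapP[p _ ->] ->]; exact: absval_bound.
  + move=> /(absval_onto w)[p <-]; exists (letter_at w p) => //.
    by apply: map_f; rewrite mem_enum.
Qed.

Lemma pattern_word_of s k w : s + k <= n -> pattern s k (word_of w) \in patterns k.
Proof.
move=> skn; apply: mem_patterns.
(* Values are compared after adding [s] back, where the pattern becomes a subword. *)
have inj : perm_eq (map (addn s) (map fst (pattern s k (word_of w))))
                   (map (addn s) (iota 1 k)).
  have -> : map (addn s) (map fst (pattern s k (word_of w))) =
            map fst (map (shift s) (pattern s k (word_of w))).
    by rewrite -!map_comp.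
  rewrite shift_pattern /subword -(filter_map fst (window s k)).
  rewrite (perm_trans (perm_filter _ (map_fst_word_of w))) //.
  rewrite -iotaDl; apply: uniq_perm; rewrite ?filter_uniq ?iota_uniq //.
  by move=> v; rewrite mem_filter !mem_iota /window; lia.
exact: (perm_map_inj (@addnI s)).
Qed.

Lemma mem_signed w p : signed w (absval w p) = w.2 p.
Proof.
apply/existsP/idP => [[q /andP[/eqP/absval_inj-> //]]|wp].
by exists p; rewrite eqxx.
Qed.

Lemma mem_right_of w p q : right_of w (absval w p) (absval w q) = (q < p).
Proof.
apply/existsP/idP => [[a /existsP[b /and3P[]]]|qp].
  by move=> /eqP/absval_inj-> /eqP/absval_inj->.
by exists p; apply/existsP; exists q; rewrite !eqxx.
Qed.

Lemma mem_sp_des w h : (h \in sp_des w) = descent h (word_of w).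
Proof.
rewrite !inE /= mem_iota; have [hn|hn] := boolP (0 < h < n); last first.
  rewrite (_ : 0 < h < 1 + n.-1 = false) /=; last by lia.
  rewrite /descent subword_word_of; set s := [seq p <- _ | _].
  have: size s <= 1.
    have us : uniq (map (absval w) s).
      rewrite map_inj_uniq; last exact: absval_inj.
      by rewrite filter_uniq ?enum_uniq.
    rewrite -(size_map (absval w)).
    have sub x : x \in map (absval w) s -> (0 < x <= n) && pair_at h x.
      by move=> /mapP[p]; rewrite mem_filter => /andP[hp _] ->; rewrite hp absval_bound.
    rewrite leqNgt; apply/negP; case: (map _ s) us sub => [|x [|y t]] //= + sub _.
    rewrite inE negb_or -andbA => /andP[/eqP xy _].
    have := sub x (mem_head _ _).
    have := sub y; rewrite !inE eqxx orbT /pair_at => /(_ isT).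
    by move: hn xy; lia.
  by case: s => [|x [|y s]].
have [p ph] : exists p, absval w p = h by apply: absval_onto; lia.
have [q qh] : exists q, absval w q = h.+1 by apply: absval_onto; lia.
rewrite (_ : 0 < h < 1 + n.-1 = true) /=; last by lia.
have -> : signed w h = w.2 p by rewrite -ph mem_signed.
have -> : signed w h.+1 = w.2 q by rewrite -qh mem_signed.
have -> : right_of w h h.+1 = (q < p) by rewrite -qh -ph mem_right_of.
have -> : right_of w h.+1 h = (p < q) by rewrite -qh -ph mem_right_of.
rewrite /descent subword_word_of.
have mem r : pair_at h (absval w r) = (r == p) || (r == q).
  by rewrite /pair_at -{1}ph -qh !(inj_eq (@absval_inj w)).
have pq : p != q.
  by apply/eqP => pq; move: qh; rewrite -pq ph; lia.
have [lt_pq|lt_qp|/val_inj epq] := ltngtP p q; last by rewrite epq eqxx in pq.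
- rewrite (@filter_enum_sorted [:: p; q]) /=; last 2 first.
  + by rewrite lt_pq.
  + by move=> r; rewrite !inE -topredE /= mem.
  by rewrite ph eqxx andbF andbT; case: (w.2 q).
- rewrite (@filter_enum_sorted [:: q; p]) /=; last 2 first.
  + by rewrite lt_qp.
  + by move=> r; rewrite !inE -topredE /= mem orbC.
  by rewrite qh eqn_leq ltnn andbT andbF orbF; case: (w.2 p).
Qed.

(** Swaps by position and substitution by value agree because [absval w] is injective. *)
Lemma word_of_phi i w : 1 < i < n -> word_of (sp_phi i w) = move i (word_of w).
Proof.
move=> i_n; have i0 : 0 < i by lia.
have sp : i \in spike n (sp_des w) = spiked i (word_of w).
  rewrite /spiked -!mem_sp_des /spike in_fset inE /= mem_iota.
  by rewrite (_ : 1 < i < 2 + n.-2 = true) //; lia.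
rewrite /sp_phi sp /move /move_letter subword_word_of.
rewrite -(@spiked_subword (triple_at i) i) ?/triple_at ?eqxx ?orbT //.
rewrite [X in spiked i X]subword_word_of.
rewrite (_ : [seq p <- _ | absval w p \in _] =
             [seq p <- enum 'I_n | triple_at i (absval w p)]); last first.
  by apply: eq_filter => p; rewrite !inE.
have: uniq [seq p <- enum 'I_n | triple_at i (absval w p)].
  by rewrite filter_uniq ?enum_uniq.
(* Both sides branch on this list; unless it has exactly three positions, both leave the word
   unchanged. *)
case: [seq p <- _ | _] => [|a [|b [|c [|d t]]]] /=; rewrite ?map_id ?if_same //.
rewrite !inE negb_or andbT => /andP[/andP[ab ac] bc].
case: ifP => _; last by rewrite map_id.
case: ifP => _; rewrite /word_of -map_comp; apply: eq_map => p /=;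
  rewrite !(inj_eq (@absval_inj w)) /letter_at /=.
- rewrite ffunE; case: tpermP => [->|->|/eqP/negbTE-> /eqP/negbTE->] //.
    by rewrite eqxx.
  by rewrite eq_sym (negbTE bc) eqxx.
- rewrite /absval /= permM; case: tpermP => [->|->|/eqP/negbTE-> /eqP/negbTE->] //.
    by rewrite eqxx.
  by rewrite eq_sym (negbTE ac) eqxx.
Qed.

End SignedPermutationWords.

(** * Schur functions of degrees 4 and 5 *)

(** The test inside [fundamental], with a list for the finite set so that it evaluates in the finite
    checks. *)
Definition fundamental_word (k : nat) (D t : seq nat) : bool :=
  [&& size t == k, sorted leq t
    & all (fun j => (nth 0 t j.-1 == nth 0 t j) ==> (j \notin D))
          (iota 1 k.-1)].

Lemma fundamentalE k (D : {fset nat}) (Ds : seq nat) m :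
  (forall h, 0 < h < k -> (h \in D) = (h \in Ds)) ->
  fundamental k D m = count (fundamental_word k Ds) (permutations m).
Proof.
move=> DDs; apply: eq_count => t; congr [&& _, _ & _].
by apply: eq_in_all => j; rewrite mem_iota => jk; rewrite DDs //; lia.
Qed.

(** * Invariance of coefficients under relabelling of the variables *)

Lemma permutations_map (f : nat -> nat) (s : seq nat) : injective f ->
  perm_eq (permutations (map f s)) (map (map f) (permutations s)).
Proof.
move=> f_inj; apply: uniq_perm; rewrite ?permutations_uniq //.
  by rewrite map_inj_uniq ?permutations_uniq //; exact: inj_map.
move=> t; rewrite mem_permutations; apply/idP/mapP; last first.
  by move=> [t' + ->]; rewrite mem_permutations; exact: perm_map.
(* [g] picks a preimage under [f] inside [s]; on the letters of [t] the default 0 is never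
   reached. *)
move=> ts; pose g y := nth 0 s (index y (map f s)).
have fg : map f (map g t) = t.
  rewrite -map_comp -[RHS]map_id; apply/eq_in_map => y.
  rewrite (perm_mem ts) => ys /=.
  by rewrite /g -(nth_map 0 0) ?nth_index // -(size_map f) index_mem.
exists (map g t) => //; rewrite mem_permutations.
by apply: (perm_map_inj f_inj); rewrite fg.
Qed.

Section OrderEmbedding.

Variable f : nat -> nat.
Hypothesis f_mono : {mono f : a b / a <= b}.

Lemma order_embedding_inj : injective f.
Proof. by move=> a b e; apply/eqP; rewrite eqn_leq -(f_mono a) -(f_mono b) e leqnn. Qed.

Lemma semistandard_map lam t : semistandard lam (map f t) = semistandard lam t.
Proof.
rewrite /semistandard -map_reshape size_map all_map sorted_map.
congr [&& _, _ & _].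
  by apply: eq_all => r /=; rewrite sorted_map; apply: eq_sorted.
apply: eq_sorted => r1 r2 /=; rewrite size_map -map_take.
move: (take _ _) => r; elim: r r2 => [|a r IH] [|b r2] //=.
by rewrite IH ltnNge f_mono -ltnNge.
Qed.

Lemma fundamental_word_map k D t :
  fundamental_word k D (map f t) = fundamental_word k D t.
Proof.
(* The size is settled first, because past the end [nth] would return 0 and not an image under
   [f]. *)
rewrite /fundamental_word size_map; have [tk|//] := eqVneq (size t) k.
rewrite sorted_map (eq_sorted f_mono); congr [&& _, _ & _].
apply: eq_in_all => j; rewrite mem_iota => jk.
by rewrite !(nth_map 0) ?(inj_eq order_embedding_inj) ?tk //; lia.
Qed.

Lemma count_permutations_map (P : pred (seq nat)) s :
  (forall t, P (map f t) = P t) ->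
  count P (permutations (map f s)) = count P (permutations s).
Proof.
move=> Pf; rewrite (seq.permP (permutations_map s order_embedding_inj)) count_map.
exact: eq_count.
Qed.

End OrderEmbedding.

(* The weakly increasing words whose set of values is an initial segment of the
   naturals; up to order isomorphism these are all weakly increasing words. *)
Fixpoint packed_words (k : nat) : seq (seq nat) :=
  if k is k'.+1 then
    map (cons 0) (packed_words k') ++
    map (fun t => 0 :: map S t) (packed_words k')
  else [:: [::]].

(** The default 1 makes the equation also say that [t] is nonempty. *)
Lemma packed_words0 k t : t \in packed_words k.+1 -> head 1 t = 0.
Proof. by rewrite /= mem_cat => /orP[]/mapP[? _ ->]. Qed.

(** Induction on [t]: a first letter equal to the next one repeats the 0, while a smaller one
    becomes a new 0 and raises all the others by one. *)
Lemma sorted_packed t : sorted leq t ->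
  exists t0 f, [/\ t0 \in packed_words (size t), {mono f : a b / a <= b}
                 & t = map f t0].
Proof.
elim: t => [|x t IH] xt; first by exists [::], id.
have [t0 [f [t0P fP et]]] := IH (path_sorted xt).
case: t et {IH} xt t0P => [|y t] et xt t0P.
  exists [:: 0], (addn x); split => //=; last by rewrite addn0.
  by move=> a b; rewrite leq_add2l.
have ey : f 0 = y.
  have := packed_words0 t0P.
  by case: t0 et {t0P} => //= z t0 [-> _] ->.
move: xt => /= /andP[xy _]; have [exy|xNy] := eqVneq x y.
  exists (0 :: t0), f; split => //=; last by rewrite ey exy et.
  by rewrite !mem_cat map_f.
(* The embedding is extended below: 0 goes to [x], and the old values move up by one. *)
exists (0 :: map S t0), (fun a => if a is a'.+1 then f a' else x); split.
- by rewrite /= mem_cat; apply/orP; right; rewrite (map_f (fun t => 0 :: map S t)).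
- have lt_x a : x < f a.
    by apply: (@leq_trans y); rewrite -?ey ?fP // ey ltn_neqAle xNy.
  case=> [|a] [|b]; rewrite ?leqnn ?fP //.
    by rewrite ltnW.
  by rewrite leqNgt lt_x.
- by rewrite /= -map_comp et.
Qed.

(* The shapes of size [k], each with the descent sets of its standard tableaux. *)
Definition tableau_descents (k : nat) : seq (seq nat * seq (seq nat)) :=
  match k with
  | 4 => [:: ([:: 4], [:: [::]]);
             ([:: 3; 1], [:: [:: 1]; [:: 2]; [:: 3]]);
             ([:: 2; 2], [:: [:: 2]; [:: 1; 3]]);
             ([:: 2; 1; 1], [:: [:: 1; 2]; [:: 1; 3]; [:: 2; 3]]);
             ([:: 1; 1; 1; 1], [:: [:: 1; 2; 3]])]
  | 5 => [:: ([:: 5], [:: [::]]);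
             ([:: 4; 1], [:: [:: 1]; [:: 2]; [:: 3]; [:: 4]]);
             ([:: 3; 2], [:: [:: 2]; [:: 3]; [:: 1; 3]; [:: 1; 4]; [:: 2; 4]]);
             ([:: 3; 1; 1], [:: [:: 1; 2]; [:: 1; 3]; [:: 1; 4];
                                [:: 2; 3]; [:: 2; 4]; [:: 3; 4]]);
             ([:: 2; 2; 1], [:: [:: 1; 3; 4]; [:: 1; 2; 4]; [:: 2; 4];
                                [:: 2; 3]; [:: 1; 3]]);
             ([:: 2; 1; 1; 1], [:: [:: 2; 3; 4]; [:: 1; 3; 4];
                                   [:: 1; 2; 4]; [:: 1; 2; 3]]);
             ([:: 1; 1; 1; 1; 1], [:: [:: 1; 2; 3; 4]])]
  | _ => [::]
  end.

(* The coefficients that make [Ds] the union of the lists in [tableau_descents]: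
   each shape has a descent set of its own, except for (2,2), (3,2) and (2,2,1),
   whose chosen set also occurs for (3,1), (4,1) and (2,1,1,1) respectively. *)
Definition multiplicities (k : nat) (Ds : seq (seq nat)) : seq nat :=
  let c D := count_mem D Ds in
  match k with
  | 4 => [:: c [::]; c [:: 1]; c [:: 2] - c [:: 1]; c [:: 1; 2]; c [:: 1; 2; 3]]
  | 5 => [:: c [::]; c [:: 1]; c [:: 2] - c [:: 1]; c [:: 1; 2];
             c [:: 1; 3; 4] - c [:: 2; 3; 4]; c [:: 2; 3; 4]; c [:: 1; 2; 3; 4]]
  | _ => [::]
  end.

Definition expand (k : nat) (cs : seq nat) : seq (seq nat) :=
  flatten [seq flatten (nseq x.1 x.2.2) | x <- zip cs (tableau_descents k)].

(** Gessel's expansion of a Schur function over standard tableaux, compared coefficient by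
    coefficient on packed contents. *)
Definition schur_expansion_ok (k : nat) : bool :=
  all (fun t =>
    let ps := permutations t in
    all (fun x => count (semistandard x.1) ps ==
                  sumn [seq count (fundamental_word k D) ps | D <- x.2])
        (tableau_descents k))
    (packed_words k).

Lemma schur_expansion_ok4 : schur_expansion_ok 4.
Proof. vm_cast_no_check (erefl true). Qed.

Lemma schur_expansion_ok5 : schur_expansion_ok 5.
Proof. vm_cast_no_check (erefl true). Qed.

Lemma tableau_descents_shape k x :
  x \in tableau_descents k -> is_partition x.1 /\ sumn x.1 = k.
Proof.
case: k => [|[|[|[|[|[|k]]]]]] // xk.
- have /allP/(_ _ xk)/andP[-> /eqP->] :
    all (fun x => is_partition x.1 && (sumn x.1 == 4)) (tableau_descents 4) by [].
  by [].
- have /allP/(_ _ xk)/andP[-> /eqP->] :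
    all (fun x => is_partition x.1 && (sumn x.1 == 5)) (tableau_descents 5) by [].
  by [].
Qed.

(** In degrees other than [k] both coefficients vanish; in degree [k] the sorted content is
    relabelled to a packed word, which the check covers. *)
Lemma schur_expansion k x (m : {mset nat}%mset) :
  schur_expansion_ok k -> x \in tableau_descents k ->
  schur x.1 m =
  \sum_(D <- x.2) count (fundamental_word k D) (permutations m).
Proof.
move=> ok xk; have [mk|mk] := eqVneq (size m) k; last first.
  have no (P : pred (seq nat)) : (forall t, P t -> size t = k) ->
      count P (permutations m) = 0.
    move=> Pk; apply/eqP; rewrite -leqn0 leqNgt -has_count; apply/hasPn => t.
    rewrite mem_permutations => /perm_size tm; apply: contra mk => /Pk <-.
    by rewrite tm.
  rewrite /schur no => [|t /and3P[/eqP-> _ _]]; last first.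
    by have [] := tableau_descents_shape xk.
  by rewrite big1 // => D _; rewrite no // => t /and3P[/eqP].
have [t0 [f [t0P fP et]]] := sorted_packed (sort_sorted leq_total m).
have em : perm_eq m (map f t0) by rewrite -et perm_sym perm_sort.
have cE (P : pred (seq nat)) : (forall t, P (map f t) = P t) ->
    count P (permutations m) = count P (permutations t0).
  move=> Pf; rewrite -(count_permutations_map fP) //.
  exact/seq.permP/perm_permutations.
rewrite /schur cE => [|t]; last exact: semistandard_map.
rewrite size_sort mk in t0P.
have /eqP-> := allP (allP ok _ t0P) _ xk.
rewrite sumnE big_map; apply: eq_bigr => D _.
by rewrite cE // => t; exact: fundamental_word_map.
Qed.

Lemma sum_expand k cs (F : seq nat -> nat) :
  \sum_(D <- expand k cs) F D =
  \sum_(x <- zip cs (tableau_descents k)) x.1 * \sum_(D <- x.2.2) F D.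
Proof.
rewrite /expand big_flatten /= big_map; apply: eq_bigr => x _.
rewrite big_flatten /=; elim: x.1 => [|c IH]; first by rewrite big_nil.
by rewrite big_cons IH mulSn.
Qed.

(** The multiplicities are only a guess, made with truncated subtraction; the [perm_eq] hypothesis
    certifies them. As the shapes are distinct, indexing by shape recovers each coefficient. *)
Lemma schur_positive_expand k (Ds : seq (seq nat)) (g : series) :
  schur_expansion_ok k -> perm_eq Ds (expand k (multiplicities k Ds)) ->
  (forall m, g m = \sum_(D <- Ds) count (fundamental_word k D) (permutations m)) ->
  schur_positive g.
Proof.
move=> ok DsE gE; set cs := multiplicities k Ds in DsE.
pose L := map fst (tableau_descents k).
exists L, (fun lam => nth 0 cs (index lam L)); split.
  by apply/allP => lam /mapP[x /tableau_descents_shape[xP _] ->].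
move=> m; rewrite gE (perm_big _ DsE) /= sum_expand /L.
have Lu : uniq L by rewrite /L; case: (k) => [|[|[|[|[|[|?]]]]]].
have sz : size cs = size (tableau_descents k).
  by rewrite /cs; case: (k) => [|[|[|[|[|[|?]]]]]].
pose x0 := ([::] : seq nat, [::] : seq (seq nat)).
rewrite (big_nth (0, x0)) size_zip sz minnn big_map (big_nth x0) /=.
rewrite !big_nat; apply: eq_bigr => j /andP[_ jk].
rewrite nth_zip //= (schur_expansion _ ok) ?mem_nth //.
congr (nth 0 cs _ * _).
by rewrite -(nth_map x0 [::]) // index_uniq // size_map.
Qed.

(** * Equivalence classes *)

Definition des_seq (k : nat) (p : word) : seq nat :=
  [seq h <- iota 1 k.-1 | descent h p].

Fixpoint orbit_search (hs : seq nat) (N : nat) (seen todo : seq word) :=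
  match N, todo with
  | N'.+1, x :: r =>
      if x \in seen then orbit_search hs N' seen r
      else orbit_search hs N' (x :: seen) ([seq move i x | i <- hs] ++ r)
  | _, _ => seen
  end.

(* The fuel 64 exceeds what orbits on at most 5 letters need (they have at most 16
   elements); completeness is checked in [is_schur_orbit] rather than proved. *)
Definition move_orbit (hs : seq nat) (p : word) : seq word :=
  orbit_search hs 64 [::] [:: p].

(** Soundness of the search: everything collected is reachable. Stating it for any [Q] lets it later
    produce class elements with given patterns. *)
Lemma orbit_search_ind (Q : word -> Prop) hs N seen todo :
  (forall p i, Q p -> i \in hs -> Q (move i p)) ->
  {in seen, forall p, Q p} -> {in todo, forall p, Q p} ->
  {in orbit_search hs N seen todo, forall p, Q p}.
Proof.
move=> Qmove; elim: N seen todo => [|N IH] seen todo Qs Qt //=.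
case: todo Qt => [|p r] Qt //.
have Qp : Q p by apply: Qt; rewrite mem_head.
have Qr : {in r, forall q, Q q} by move=> q qr; apply: Qt; rewrite inE qr orbT.
case: ifP => _; apply: IH => //.
- by move=> q; rewrite inE => /predU1P[-> //|/Qs].
- by move=> q; rewrite mem_cat => /orP[/mapP[i ih ->]|/Qr //]; apply: Qmove.
Qed.

Lemma move_orbit_ind (Q : word -> Prop) hs p :
  Q p -> (forall q i, Q q -> i \in hs -> Q (move i q)) ->
  {in move_orbit hs p, forall q, Q q}.
Proof.
move=> Qp Qmove; rewrite /move_orbit; apply: orbit_search_ind => // q.
by rewrite inE => /eqP->.
Qed.

(** Membership of [p] and closure under the moves show that [o] contains the whole orbit; the
    converse comes from the induction principle in [orbit_okP]. *)
Definition is_schur_orbit (k : nat) (p : word) (o : seq word) : bool :=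
  let Ds := map (des_seq k) o in
  [&& uniq o, p \in o, all (fun q => all (fun i => move i q \in o) (iota 2 k.-2)) o
    & perm_eq Ds (expand k (multiplicities k Ds))].

Definition orbit_ok (k : nat) (p : word) : bool :=
  is_schur_orbit k p (move_orbit (iota 2 k.-2) p).

Lemma orbit_ok4 : all (orbit_ok 4) (patterns 4).
Proof. vm_cast_no_check (erefl true). Qed.

Lemma orbit_ok5 : all (orbit_ok 5) (patterns 5).
Proof. vm_cast_no_check (erefl true). Qed.

Lemma orbit_okP k p : orbit_ok k p ->
  exists2 o, is_schur_orbit k p o &
    forall Q : word -> Prop, Q p ->
      (forall q i, Q q -> i \in iota 2 k.-2 -> Q (move i q)) ->
      {in o, forall q, Q q}.
Proof.
rewrite /orbit_ok => ok; exists (move_orbit (iota 2 k.-2) p); first exact ok.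
by move=> Q; exact: move_orbit_ind.
Qed.

(** * Classes generated inside one window *)

Section Classes.

Variables (n s k : nat).
Hypotheses (k_gt2 : 2 < k) (skn : s + k <= n).
Implicit Types T U : signed_perm n.

(** The indices s+2, ..., s+k-1 are those whose three values all lie in the window s+1, ..., s+k. *)
Let class T := wde_class (@sp_phi n) (s + 2) (s + k.-1) T.
Let pat U := pattern s k (word_of U).

Lemma pattern_phi i U : 1 < i < k ->
  pat (sp_phi (s + i) U) = move i (pat U).
Proof. by move=> ik; rewrite /pat word_of_phi ?pattern_move //; lia. Qed.

Lemma class_ind (Q : signed_perm n -> Prop) T :
  Q T -> (forall U i, Q U -> 1 < i < k -> Q (sp_phi (s + i) U)) ->
  {in class T, forall U, Q U}.
Proof.
move=> QT Qphi U; rewrite inE => /connectP[p pP ->].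
elim/last_ind: p pP => [|p V IH] //; rewrite rcons_path last_rcons.
move=> /andP[/IH QV /hasP[h]]; rewrite mem_iota => hk /eqP<-.
rewrite (_ : h = s + (h - s)); last by lia.
by apply: Qphi => //; lia.
Qed.

Lemma class_refl T : T \in class T.
Proof. by rewrite inE connect0. Qed.

Lemma class_phi T U i : 1 < i < k -> U \in class T ->
  sp_phi (s + i) U \in class T.
Proof.
move=> ik; rewrite !inE => TU; apply: connect_trans TU (connect1 _).
by apply/hasP; exists (s + i); rewrite ?eqxx // mem_iota; lia.
Qed.

(** [pat] is a bijection from the class to [o]: injective since class members agree outside the
    window, into [o] by closure, and onto by induction over the search. *)
Lemma class_orbit T o : is_schur_orbit k (pat T) o ->
  (forall Q : word -> Prop, Q (pat T) ->
     (forall q i, Q q -> i \in iota 2 k.-2 -> Q (move i q)) ->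
     {in o, forall q, Q q}) ->
  perm_eq (map pat (enum (class T))) o.
Proof.
move=> /and4P[o_uniq o_refl o_closed _] o_ind; apply: uniq_perm => //.
  rewrite map_inj_in_uniq ?enum_uniq // => U V; rewrite !mem_enum => UT VT eUV.
  apply: word_of_inj; apply: (@pattern_inj s k) => //.
  have out W : W \in class T -> same_outside s k (word_of T) (word_of W).
    move: W; apply: class_ind => [//|W i TW ik].
    by rewrite word_of_phi; [apply: same_outside_move | lia].
  have [e1 e2] := out _ UT; have [e3 e4] := out _ VT.
  by split; rewrite -?e1 -?e2.
move=> q; apply/mapP/idP => [[U + ->]|qo].
  rewrite mem_enum; move: U; apply: class_ind => // U i oU ik.
  rewrite pattern_phi //; apply: (allP (allP o_closed _ oU)).
  by rewrite mem_iota; lia.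
have [||U UT ->] :=
  o_ind (fun q => exists2 U, U \in class T & q = pat U) _ _ q qo;
  last by exists U; rewrite ?mem_enum.
- by exists T; first exact: class_refl.
- move=> _ i [U UT ->]; rewrite mem_iota => ik; exists (sp_phi (s + i) U).
    by apply: class_phi => //; lia.
  by rewrite pattern_phi //; lia.
Qed.

(** Here [des_restr] keeps the descents s+1, ..., s+k-1 and subtracts s, the same renumbering as in
    [pattern]. *)
Lemma mem_des_restr U h : 0 < h < k ->
  (h \in des_restr (@sp_des n) (s + 2) (s + k.-1) U) = (h \in des_seq k (pat U)).
Proof.
move=> hk; rewrite mem_filter mem_iota descent_pattern // -mem_sp_des.
rewrite (_ : 0 < h < _ = true) ?andbT; last by lia.
apply/imfsetP/idP => /= [[h' + ->]|hU].
  rewrite inE => /andP[hU bnd]; rewrite (_ : s + _ = h') //; lia.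
by exists (s + h); [rewrite inE hU /=; lia | lia].
Qed.

Lemma schur_positive_class T :
  all (orbit_ok k) (patterns k) -> schur_expansion_ok k ->
  schur_positive (wde_gf (@sp_des n) (@sp_phi n) (s + 2) (s + k.-1) T).
Proof.
move=> /allP/(_ _ (pattern_word_of T skn))/orbit_okP[o ok o_ind] schur_ok.
have o_class := class_orbit ok o_ind; have /and4P[_ _ _ DsE] := ok.
apply: (schur_positive_expand schur_ok DsE) => m.
rewrite big_map -(perm_big _ o_class) big_map big_enum /wde_gf /=.
apply: eq_bigr => U _.
rewrite (_ : s + k.-1 - (s + 2) + 3 = k); last by lia.
by apply: fundamentalE => h hk; exact: mem_des_restr.
Qed.

End Classes.

(** * The axioms *)

(** In the window i-1, i, i+1 the index i becomes 2. The windows of size 4 below add the value i-2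
    (then i becomes 3) or i+2. *)
Lemma move2K : all (fun p => move 2 (move 2 p) == p) (patterns 3).
Proof. vm_cast_no_check (erefl true). Qed.

Lemma move2_fixed : all (fun p => (move 2 p == p) == ~~ spiked 2 p) (patterns 3).
Proof. vm_cast_no_check (erefl true). Qed.

Lemma descent_move2 :
  all (fun p => spiked 2 p ==>
         (descent 1 (move 2 p) == ~~ descent 1 p) &&
         (descent 2 (move 2 p) == ~~ descent 2 p)) (patterns 3).
Proof. vm_cast_no_check (erefl true). Qed.

Lemma descent_move_left :
  all (fun p => spiked 3 p ==> (descent 1 (move 3 p) != descent 1 p) ==>
         spiked 2 p) (patterns 4).
Proof. vm_cast_no_check (erefl true). Qed.

Lemma descent_move_right :
  all (fun p => spiked 2 p ==> (descent 3 (move 2 p) != descent 3 p) ==>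
         spiked 3 p) (patterns 4).
Proof. vm_cast_no_check (erefl true). Qed.

(** Three spikes make the descents 1 to 4 alternate. [move 3] flips 2 and 3, so keeping all three
    spikes would require flipping 1 and 4 as well; this never happens. *)
Lemma no_triple_spike :
  all (fun p => ~~ [&& spiked 2 p, spiked 3 p, spiked 4 p,
         spiked 2 (move 3 p), spiked 3 (move 3 p) & spiked 4 (move 3 p)])
    (patterns 5).
Proof. vm_cast_no_check (erefl true). Qed.

Section Moves.

Variable n : nat.
Implicit Types (T w : signed_perm n).

Lemma sp_phiK i : 1 < i < n -> involutive (@sp_phi n i).
Proof.
move=> i_n w; apply: word_of_inj; rewrite !word_of_phi //.
rewrite (_ : i = i - 2 + 2); last by lia.
apply: esym; apply: (@pattern_inj (i - 2) 3).
  by do 2 apply: same_outside_move => //.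
rewrite !pattern_move //; apply/esym/eqP.
by apply: (allP move2K); apply: pattern_word_of; lia.
Qed.

Lemma notin_fixpts i w : 1 < i < n ->
  (w \notin fixpts (@sp_phi n) i) = spiked i (word_of w).
Proof.
move=> i_n; rewrite inE -(inj_eq (@word_of_inj n)) word_of_phi //.
rewrite (_ : i = i - 2 + 2); last by lia.
set s := i - 2; have wP : pattern s 3 (word_of w) \in patterns 3.
  by apply: pattern_word_of; lia.
rewrite -(@spiked_pattern s 3) // -[RHS]negbK -(eqP (allP move2_fixed _ wP)).
congr negb; rewrite -pattern_move //; apply/eqP/eqP => [-> //|e].
by apply/esym/(@pattern_inj s 3) => //; apply: same_outside_move.
Qed.

Lemma descent_phi_mid i j w : 1 < i < n -> spiked i (word_of w) ->
  j = i.-1 \/ j = i -> (j \in sp_des (sp_phi i w)) = (j \notin sp_des w).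
Proof.
move=> i_n; rewrite !mem_sp_des word_of_phi //.
rewrite (_ : i = i - 2 + 2); last by lia.
set s := i - 2; have wP : pattern s 3 (word_of w) \in patterns 3.
  by apply: pattern_word_of; lia.
rewrite -(@spiked_pattern s 3) // => sp.
have := allP descent_move2 _ wP; rewrite sp /= -pattern_move //.
rewrite !descent_pattern // => /andP[/eqP d1 /eqP d2].
by case=> ->; rewrite // (_ : (s + 2).-1 = s + 1) //; lia.
Qed.

Lemma spike_phi_left i w : 2 < i < n -> spiked i (word_of w) ->
  (i - 2 \in sp_des (sp_phi i w)) != (i - 2 \in sp_des w) ->
  spiked i.-1 (word_of w).
Proof.
have [ilt|] := leqP 3 i; last by lia.
rewrite -(subnK ilt); move: (i - 3) => s i_n.
rewrite !mem_sp_des word_of_phi; last by lia.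
have wP : pattern s 4 (word_of w) \in patterns 4 by apply: pattern_word_of; lia.
rewrite (_ : s + 3 - 2 = s + 1); last by lia.
rewrite (_ : (s + 3).-1 = s + 2); last by lia.
rewrite -!(@spiked_pattern s 4) // -!(@descent_pattern s 4) // pattern_move //.
by move=> h1 h2; have := allP descent_move_left _ wP; rewrite h1 h2.
Qed.

Lemma spike_phi_right i w : 1 < i -> i.+1 < n -> spiked i (word_of w) ->
  (i.+1 \in sp_des (sp_phi i w)) != (i.+1 \in sp_des w) ->
  spiked i.+1 (word_of w).
Proof.
move=> ilt; rewrite -(subnK ilt); move: (i - 2) => s i_n.
rewrite !mem_sp_des word_of_phi; last by lia.
have wP : pattern s 4 (word_of w) \in patterns 4 by apply: pattern_word_of; lia.
rewrite -addnS -!(@spiked_pattern s 4) // -!(@descent_pattern s 4) //.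
rewrite pattern_move //.
by move=> h1 h2; have := allP descent_move_right _ wP; rewrite h1 h2.
Qed.

End Moves.

(** The window starts at i-3, so i-2, i, i+1 become 2, 4, 5. [true] is returned when the path stops;
    running out of fuel gives [false], so success also certifies that the path ends within the
    bound. *)
Fixpoint chain_ok (N : nat) (p : word) : bool :=
  if N is N'.+1 then
    if spiked 2 p then
      let q := move 2 p in
      if spiked 4 q then
        let r := move 4 q in if spiked 5 r then chain_ok N' r else false
      else true
    else true
  else false.

(** The hypotheses of the second half of (iv-b); nested conditionals spare the later tests under
    strict evaluation. *)
Definition chain_start (p : word) : bool :=
  if spiked 4 p then
    if spiked 5 p then
      if spiked 5 (move 4 p) then ~~ spiked 5 (move 4 (move 2 p)) else false
    else false
  else false.

Lemma chain_ok6 :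
  all (fun p => if chain_start p then chain_ok 3 (move 4 p) else true)
    (patterns 6).
Proof. vm_cast_no_check (erefl true). Qed.

Lemma chain_okP N p m : chain_ok N p -> 0 < m ->
  let psi q := move 4 (move 2 q) in
  (forall l, l < m -> spiked 2 (iter l psi p) /\ spiked 4 (move 2 (iter l psi p))) ->
  spiked 5 (iter m psi p).
Proof.
move=> ok m0 psi; elim: N p m m0 ok => [|N IH] p [|m] //= _ ok stops.
(* The path does not stop in this round, so the check must have passed through the test of
   [spiked 5]. *)
have [/= p2 p4] := stops 0 isT; move: ok; rewrite p2 p4.
case: ifP => // p5 ok; rewrite -iterS iterSr.
case: m stops => [|m] stops //; apply: IH => // l lm.
by rewrite -iterSr; apply: stops.
Qed.

Theorem theorem5p2 (n : nat) (hn : 3 <= n) :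
  @weak_dual_equivalence (signed_perm n) n (@sp_des n) (@sp_phi n).
Proof.
have fixE i w (i_n : 1 < i < n) := @notin_fixpts n i w i_n.
have desP (T : signed_perm n) h : h \in sp_des T -> 0 < h < n.
  by rewrite !inE mem_iota => /andP[]; lia.
have notin_des (T : signed_perm n) h : ~~ (0 < h < n) -> (h \in sp_des T) = false.
  by move=> hn'; apply: contraNF hn' => /desP.
split.
- exact: desP.
- exact: sp_phiK.
- move=> i i_n; apply/setP => T; rewrite [RHS]inE -[LHS]negbK (fixE _ _ i_n).
  by rewrite /spiked -!mem_sp_des negb_add.
- move=> i T i_n _ h hi.
  by rewrite !mem_sp_des word_of_phi // descent_move_far.
- move=> i T i_n Ti eD; rewrite (fixE i T i_n) in Ti.
  have neq : (i - 2 \in sp_des (sp_phi i T)) != (i - 2 \in sp_des T).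
    by case: (i - 2 \in _) eD; case: (i - 2 \in _) => // -[h1 h2];
      [have := h1 isT | have := h2 isT].
  (* For i = 2 the index i-2 is 0, never a descent, so its status could not change. *)
  have i3 : 2 < i < n.
    suff : i - 2 != 0 by lia.
    by apply: contra neq => /eqP->; rewrite !notin_des.
  by rewrite fixE; [apply: spike_phi_left | lia].
- move=> i T i_n Ti eD; rewrite (fixE i T i_n) in Ti.
  have neq : (i.+1 \in sp_des (sp_phi i T)) != (i.+1 \in sp_des T).
    by case: (i.+1 \in _) eD; case: (i.+1 \in _) => // -[h1 h2];
      [have := h1 isT | have := h2 isT].
  (* Likewise, i+1 = n is never a descent. *)
  have i3 : i.+1 < n.
    rewrite ltnNge; apply: contra neq => ni.
    by rewrite !notin_des //; lia.
  by rewrite fixE; [apply: spike_phi_right; lia | lia].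
- move=> i T i_n Ti j ij; rewrite (fixE i T i_n) in Ti.
  by rewrite descent_phi_mid // negbK.
- move=> i j T i_n j_n ij; apply: word_of_inj; rewrite !word_of_phi //.
  by case/orP: ij => ij; [|apply: esym]; apply: move_comm.
(* With s = i-3 the window i-2, ..., i+1 has four letters, and the generators i-1, i become 2, 3. *)
- move=> i T /andP[i2 i_n].
  move: i_n; rewrite -(subnK i2); move: (i - 3) => s i_n.
  rewrite (_ : (s + 3).-1 = s + 2); last by lia.
  apply: (@schur_positive_class n s 4 _ _ T orbit_ok4 schur_expansion_ok4);
    lia.
- move=> i T i2; rewrite -(subnK i2); move: (i - 3) => s i_n TN UN; exfalso.
  move: TN UN; rewrite !in_setU !negb_or -!andbA => /and3P[T2 T3 T4] /and3P[U2 U3 U4].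
  have TP : pattern s 5 (word_of T) \in patterns 5 by apply: pattern_word_of; lia.
  have e2 : (s + 3).-1 = s + 2 by lia.
  have sp j w : 1 < j < 5 -> w \notin fixpts (@sp_phi n) (s + j) ->
      spiked j (pattern s 5 (word_of w)).
    by move=> j5 wj; rewrite spiked_pattern // -fixE //; lia.
  rewrite e2 in T2 U2; rewrite -addnS in T4 U4.
  have Upat : pattern s 5 (word_of (sp_phi (s + 3) T)) =
      move 3 (pattern s 5 (word_of T)).
    by rewrite word_of_phi ?pattern_move //; lia.
  have := allP no_triple_spike _ TP.
  by rewrite -Upat !sp.
(* With s = i-4 the window i-3, ..., i+1 has five letters, and the generators i-2, i-1, i become 2,
   3, 4. *)
- move=> i T /andP[i3 i_n].
  move: i_n; rewrite -(subnK i3); move: (i - 4) => s i_n.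
  rewrite (_ : s + 4 - 2 = s + 2); last by lia.
  apply: (@schur_positive_class n s 5 _ _ T orbit_ok5 schur_expansion_ok5);
    lia.
- move=> i T i3; rewrite -(subnK i3); move: (i - 4) => s i_n.
  have TP : pattern s 6 (word_of T) \in patterns 6.
    by apply: pattern_word_of; lia.
  have e2 : s + 4 - 2 = s + 2 by lia.
  rewrite e2 -addnS => T4 T5 U5 V5 U psi m m0 stops.
  have sp j w : 1 < j < 6 -> (w \notin fixpts (@sp_phi n) (s + j)) =
      spiked j (pattern s 6 (word_of w)).
    by move=> j6; rewrite spiked_pattern // fixE //; lia.
  have pat_phi j (w : signed_perm n) : 1 < j < 6 ->
      pattern s 6 (word_of (sp_phi (s + j) w)) = move j (pattern s 6 (word_of w)).
    by move=> j6; rewrite word_of_phi ?pattern_move //; lia.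
  (* The whole path stays inside one window of six letters, so it can be followed on patterns. *)
  have pat_iter l : pattern s 6 (word_of (iter l psi U)) =
      iter l (fun q => move 4 (move 2 q)) (move 4 (pattern s 6 (word_of T))).
    by elim: l => [|l /= <-]; rewrite !pat_phi.
  rewrite sp // pat_iter; apply: (chain_okP (N := 3)) => //.
    have := allP chain_ok6 _ TP; rewrite /chain_start -!pat_phi // -!sp //.
    by rewrite T4 T5 U5 V5.
  by move=> l /stops; rewrite !sp // pat_phi // pat_iter.
Qed.
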